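(* Let $G$ be a real-valued function with $G_*=\min_\mu G(\mu)$, $\mathcal{G}_*=\{\mu\mid G(\mu)=G_*\}$, and $\mu_*\in\mathcal{G}_*$. Then for all $\mu$: (1) If $G$ is $\mathcal{H}(\Psi)$-smooth, then $\Psi^*(\nabla G(\mu))\le G(\mu)-G_*\le\Psi(\mu-\mu_* )$. (2) If $G$ is $\mathcal{H}(\psi)$-convex, then $\psi(\mu-\mu_* )\le G(\mu)-G_*\le\psi^*(\nabla G(\mu))$. (3) If $G$ is both $\mathcal{H}(\Psi)$-smooth and $\mathcal{H}(\psi)$-convex, then $\Psi^*(\nabla G(\mu))\le G(\mu)-G_*\le\psi^*(\nabla G(\mu))$.
   Context: $G:\mathbb{R}^m\to\mathbb{R}$ is continuous with finitely many non-differentiable points; at any point where $G$ is not differentiable, $\nabla G$ is set to $\mathbf{0}$ by convention. Energy function: a function $\Psi:\mathbb{R}^m\to\mathbb{R}$ that is a Legendre function (proper, lower semicontinuous, convex, essentially smooth and essentially strictly convex), whose unique minimum is attained at the origin, and which has the radial form $\Psi(\mu)=\Psi_\circ(\|\mu\|)$ for some norm $\|\cdot\|$ on $\mathbb{R}^m$. Let $S_G(\mu,\nu)=G(\mu)-G(\nu)-\langle\nabla G(\nu),\mu-\nu\rangle$. $G$ is $\mathcal{H}(\Psi)$-smooth if $\Psi$ is an energy function and $S_G(\mu,\nu)\le\Psi(\mu-\nu)$ for all $\mu,\nu$ in the domain of $G$. $G$ is $\mathcal{H}(\psi)$-convex if $\psi$ is an energy function and $S_G(\mu,\nu)\ge\psi(\mu-\nu)$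 for all $\mu,\nu$ in the domain of $G$. $\Psi^*(\nu)=\sup_\mu\{\langle\mu,\nu\rangle-\Psi(\mu)\}$ is the convex conjugate, similarly $\psi^*$. *)

(* Defs.v *)
From HB Require Import structures.
From mathcomp Require Export all_boot all_order all_algebra.
From mathcomp Require Export all_classical all_reals all_analysis.

Set Implicit Arguments.
Unset Strict Implicit.
Unset Printing Implicit Defensive.

Export Order.TTheory GRing.Theory Num.Theory.
Export numFieldNormedType.Exports.

Local Open Scope classical_set_scope.
Local Open Scope ring_scope.

Section Definitions.
Context {R : realType} {m : nat}.
Local Notation V := 'rV[R]_m.

Definition dotp (u v : V) : R := \sum_(i < m) u 0 i * v 0 i.

(** By convention the gradient is [0] where [F] is not (Frechet)
    differentiable, even if all the partial derivatives exist there. *)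
Definition gradient (F : V -> R) (x : V) : V :=
  if `[< differentiable F x >] then \row_(j < m) 'D_(delta_mx 0 j) F x else 0.

Definition minimizers (F : V -> R) (Fmin : R) : set V := [set x | F x = Fmin].

(** ** Legendre functions, for extended-real-valued functions
    (Rockafellar, Convex Analysis, Section 26) *)

Definition effective_domain (f : V -> \bar R) : set V :=
  [set x | (f x < +oo)%E].

Definition proper_function (f : V -> \bar R) : Prop :=
  effective_domain f !=set0 /\ forall x, (-oo < f x)%E.

(** Only used together with [proper_function], so that the sum on the
    right-hand side is never of the form [+oo - oo]. *)
Definition econvex (f : V -> \bar R) : Prop :=
  forall (x y : V) (t : R), 0 < t -> t < 1 ->
    (f (t *: x + (1 - t) *: y)%R
       <= t%:E * f x + (1 - t)%:E * f y)%E.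

Definition strictly_econvex_on (D : set V) (f : V -> \bar R) : Prop :=
  forall (x y : V) (t : R), D x -> D y -> x != y -> 0 < t -> t < 1 ->
    (f (t *: x + (1 - t) *: y)%R
       < t%:E * f x + (1 - t)%:E * f y)%E.

Definition subdifferential (f : V -> \bar R) (x : V) : set V :=
  [set g | forall y, (f x + (dotp g (y - x)%R)%:E <= f y)%E].

(** On the interior of its effective domain a proper [f] coincides with the
    real-valued function [fine \o f].  The norm [`|_|] on row vectors is the
    sup norm; in the blow-up condition any norm may be used, since norms on
    [V] are equivalent. *)
Definition essentially_smooth (f : V -> \bar R) : Prop :=
  let C := interior (effective_domain f) in
  [/\ C !=set0,
      forall x, C x -> differentiable (fine \o f) x
    & forall (u : nat -> V) (x : V),
        (forall n, C (u n)) -> u n @[n --> \oo] --> x ->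
        closure C x -> ~ C x ->
        `|gradient (fine \o f) (u n)| @[n --> \oo] --> +oo].

Definition essentially_strictly_convex (f : V -> \bar R) : Prop :=
  forall D : set V, convex_set D ->
    D `<=` [set x | subdifferential f x !=set0] ->
    strictly_econvex_on D f.

Record legendre_function (f : V -> \bar R) : Prop := LegendreFunction {
  legendre_proper : proper_function f ;
  legendre_lsc : lower_semicontinuous f ;
  legendre_convex : econvex f ;
  legendre_smooth : essentially_smooth f ;
  legendre_strict : essentially_strictly_convex f }.

(** ** Energy functions *)

(** An arbitrary norm on [V], unrelated to the canonical [`|_|]. *)
Record is_norm (N : V -> R) : Prop := IsNorm {
  is_norm_triangle : forall x y, N (x + y) <= N x + N y ;
  is_norm_scale : forall (a : R) x, N (a *: x) = `|a| * N x ;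
  is_norm_definite : forall x, N x = 0 -> x = 0 }.

Record energy_function (Psi : V -> R) : Prop := EnergyFunction {
  energy_legendre : legendre_function (EFin \o Psi) ;
  energy_unique_min : forall x, x != 0 -> Psi 0 < Psi x ;
  energy_radial : exists (N : V -> R) (Psi0 : R -> R),
    is_norm N /\ forall x, Psi x = Psi0 (N x) }.

Definition linearization_gap (G : V -> R) (mu nu : V) : R :=
  G mu - G nu - dotp (gradient G nu) (mu - nu).

Definition H_smooth (Psi G : V -> R) : Prop :=
  energy_function Psi /\
  forall mu nu, linearization_gap G mu nu <= Psi (mu - nu).

Definition H_convex (psi G : V -> R) : Prop :=
  energy_function psi /\
  forall mu nu, psi (mu - nu) <= linearization_gap G mu nu.

(** Extended-real-valued: the supremum may be [+oo]. *)
Definition convex_conjugate (Psi : V -> R) (nu : V) : \bar R :=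
  ereal_sup (range (fun mu : V => (dotp mu nu - Psi mu)%:E)).

End Definitions.

(* Main.v *)
Require Import Defs.
From mathcomp Require Import lra.

Local Open Scope classical_set_scope.
Local Open Scope ring_scope.

(** Both inequalities of each part are instances of the hypothesis on the
    linearization gap [S_G]: the one involving [mustar] is [S_G mu mustar], where
    [gradient G mustar = 0]; the smooth conjugate bound comes from
    [S_G (mu - nu) mu] for every [nu], since [Psi] is even, and the convex one
    from [S_G mustar mu]. *)

Section EnergyBounds.
Context {R : realType} {m : nat}.
Local Notation V := 'rV[R]_m.
Implicit Types (F G Psi : V -> R) (x v mu : V).

Lemma dotpC (u v : V) : dotp u v = dotp v u.
Proof. by apply: eq_bigr => i _; rewrite mulrC. Qed.

Lemma dotp0 (u : V) : dotp 0 u = 0.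
Proof. by apply: big1 => i _; rewrite mxE mul0r. Qed.

Lemma dotpNr (u v : V) : dotp u (- v) = - dotp u v.
Proof. by rewrite -sumrN; apply: eq_bigr => i _; rewrite mxE mulrN. Qed.

(** For [h > 0] the difference quotient at a minimizer is a product of nonnegative factors, so the
    derivative is computed as a limit from the right. *)
Lemma derive_min_ge0 F x v :
  (forall y, F x <= F y) -> derivable F x v -> 0 <= 'D_v F x.
Proof.
move=> Fx dF; rewrite ['D_v F x]cvg_at_rightE //; apply: limr_ge.
  (* Right neighbourhoods of 0 refine the punctured ones, so the one-sided limit exists. *)
  rewrite -(cvg_at_rightE (fun h : R => h^-1 *: ((F \o shift x) _ - F x))) //.
  apply: cvg_trans dF; apply: cvg_app => A [e e0 Ae].
  by exists e => // y ye y0; apply: Ae => //; exact: lt0r_neq0.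
near=> h; apply: mulr_ge0; last by rewrite subr_ge0 Fx.
by rewrite invr_ge0 ltW//; near: h; exact: nbhs_right_gt.
Unshelve. all: by end_near. Qed.

(** Fermat's rule; where [F] is not differentiable the convention on [gradient] already gives 0. *)
Lemma gradient_min F x : (forall y, F x <= F y) -> gradient F x = 0.
Proof.
move=> Fx; rewrite /gradient; case: asboolP => // dF.
apply/rowP => j; rewrite !mxE; apply/le_anti/andP; split; last first.
  by apply: derive_min_ge0 => //; exact: diff_derivable.
(* By linearity of the differential, the upper bound is the lower bound in the opposite
   direction. *)
rewrite -oppr_ge0 deriveE// -linearN -deriveE//.
by apply: derive_min_ge0 => //; exact: diff_derivable.
Qed.

Lemma energy_even Psi v : energy_function Psi -> Psi (- v) = Psi v.
Proof.
case=> _ _ [N [Psi0 [[_ NZ _] PsiE]]].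
by rewrite !PsiE -scaleN1r NZ normrN1 mul1r.
Qed.

Lemma linearization_gap_min G x mu :
  (forall y, G x <= G y) -> linearization_gap G mu x = G mu - G x.
Proof. by move=> Gx; rewrite /linearization_gap gradient_min// dotp0 subr0. Qed.

(** Each term of the supremum is at most [G mu - G (mu - v)], hence at most [G mu - c]. *)
Lemma conjugate_le_of_H_smooth Psi G c mu : lbound (range G) c ->
  H_smooth Psi G ->
  (convex_conjugate Psi (gradient G mu) <= (G mu - c)%:E)%E.
Proof.
move=> Gc [enPsi gapG]; apply: ge_ereal_sup => _ [v _ <-].
have := gapG (mu - v) mu; rewrite /linearization_gap.
rewrite [mu - v - mu]addrAC subrr add0r dotpNr energy_even// dotpC lee_fin.
have : c <= G (mu - v) by apply: Gc; exists (mu - v).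
lra.
Qed.

(** The term of the supremum at [mu - x] is already large enough, whatever [x] is. *)
Lemma le_conjugate_of_H_convex psi G x mu : H_convex psi G ->
  ((G mu - G x)%:E <= convex_conjugate psi (gradient G mu))%E.
Proof.
move=> [enpsi gapG]; apply: le_trans (ereal_sup_ubound _); last first.
  by exists (mu - x).
have := gapG x mu; rewrite /linearization_gap.
by rewrite -opprB energy_even// dotpNr dotpC lee_fin; lra.
Qed.

End EnergyBounds.

Theorem theorem6 (R : realType) (m : nat) (G : 'rV[R]_m -> R)
    (G_continuous : continuous G)
    (G_finite_nondiff : finite_set [set x | ~ differentiable G x])
    (Gmin : R)
    (Gmin_lower : lbound (range G) Gmin) (Gmin_attained : range G Gmin)
    (mustar : 'rV[R]_m) (mustar_min : minimizers G Gmin mustar)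
    (mu : 'rV[R]_m) :
  [/\ (forall Psi : 'rV[R]_m -> R, H_smooth Psi G ->
         (convex_conjugate Psi (gradient G mu) <= (G mu - Gmin)%:E)%E /\
         G mu - Gmin <= Psi (mu - mustar)),
      (forall psi : 'rV[R]_m -> R, H_convex psi G ->
         psi (mu - mustar) <= G mu - Gmin /\
         ((G mu - Gmin)%:E <= convex_conjugate psi (gradient G mu))%E)
    & (forall Psi psi : 'rV[R]_m -> R, H_smooth Psi G -> H_convex psi G ->
         (convex_conjugate Psi (gradient G mu) <= (G mu - Gmin)%:E)%E /\
         ((G mu - Gmin)%:E <= convex_conjugate psi (gradient G mu))%E)].
Proof.
have Gmu : G mustar = Gmin := mustar_min.
have Gle y : G mustar <= G y by rewrite Gmu; apply: Gmin_lower; exists y.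
have smooth_conj Psi : H_smooth Psi G ->
    (convex_conjugate Psi (gradient G mu) <= (G mu - Gmin)%:E)%E.
  exact: conjugate_le_of_H_smooth.
have convex_conj psi : H_convex psi G ->
    ((G mu - Gmin)%:E <= convex_conjugate psi (gradient G mu))%E.
  by move=> cG; rewrite -Gmu; exact: le_conjugate_of_H_convex.
(* [auto] closes all conjugate bounds, hence all of part (3); the energies at [mu - mustar]
   remain. *)
split=> [Psi sG|psi cG|Psi psi sG cG]; split; auto.
- by rewrite -Gmu -linearization_gap_min//; exact: sG.2.
- by rewrite -Gmu -linearization_gap_min//; exact: cG.2.
Qed.
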